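(* Let $\lambda>0$ and let $F_\lambda$ be the cumulative distribution function with density $f_\lambda(x)=2\phi(x)\Phi(\lambda x)$, $x\in\mathbb{R}$. For each positive integer $n$, let $b_n$ be the solution of the equation $\sqrt{\pi/2}\,b_n\exp\left(\tfrac12 b_n^2\right)=n$ and let $a_n=b_n^{-1}$. Then there exist positive constants $C$ and $C_\lambda$, independent of $n$, such that for all integers $n\ge 9$, $$\frac{C}{\log n}<\sup_{x\in\mathbb{R}}\left|F_\lambda^n(a_nx+b_n)-\Lambda(x)\right|<\frac{C_\lambda}{\log n},$$ where $\Lambda(x)=\exp(-\exp(-x))$ and $F_\lambda^n(y)=(F_\lambda(y))^n$.
   Context: $\phi$ and $\Phi$ denote, respectively, the probability density function and the cumulative distribution function of the standard normal distribution. $F_\lambda$ is the cumulative distribution function of the standard skew-normal distribution with parameter $\lambda$, i.e. $F_\lambda(y)=\int_{-\infty}^y 2\phi(t)\Phi(\lambda t)\,dt$. $\Lambda(x)=\exp(-\exp(-x))$ is the Gumbel extreme value distribution function. *)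

(* Defs.v *)
From HB Require Import structures.
From mathcomp Require Import all_boot all_order all_algebra.
From mathcomp Require Import all_classical all_reals all_analysis.
Import Order.TTheory GRing.Theory Num.Theory.
Import numFieldNormedType.Exports.

Set Implicit Arguments.
Unset Strict Implicit.
Unset Printing Implicit Defensive.

Local Open Scope classical_set_scope.
Local Open Scope ring_scope.

Definition std_normal_pdf {R : realType} (x : R) : R := normal_pdf 0 1 x.

Definition std_normal_cdf {R : realType} (x : R) : R :=
  \int[lebesgue_measure]_(t in `]-oo, x]) std_normal_pdf t.

Definition skew_normal_pdf {R : realType} (lambda x : R) : R :=
  2 * std_normal_pdf x * std_normal_cdf (lambda * x).

Definition skew_normal_cdf {R : realType} (lambda y : R) : R :=
  \int[lebesgue_measure]_(t in `]-oo, y]) skew_normal_pdf lambda t.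

Definition gumbel_cdf {R : realType} (x : R) : R := expR (- expR (- x)).

(* The equation determines [b] because its left-hand side is nonpositive for
   [b <= 0] and increasing for [b >= 0]; see [norming_eq_exists_unique]. *)
Definition norming_eq {R : realType} (n : nat) (b : R) : Prop :=
  Num.sqrt (pi / 2) * b * expR (2^-1 * b ^+ 2) = n%:R.

Lemma norming_eq_exists_unique {R : realType} (n : nat) :
  (0 < n)%N -> exists! b : R, norming_eq n b.
Proof.
move=> n0; rewrite /norming_eq.
pose f (b : R) := Num.sqrt (pi / 2) * b * expR (2^-1 * b ^+ 2).
have s0 : 0 < Num.sqrt (pi / 2) :> R by rewrite sqrtr_gt0 divr_gt0// pi_gt0.
have s1 : 1 <= Num.sqrt (pi / 2) :> R.
  by rewrite -[leLHS]sqrtr1 ler_wsqrtr// ler_pdivlMr// mul1r pi_ge2.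
have nR : 0 < n%:R :> R by rewrite ltr0n.
have fc : continuous f.
  move=> x; apply: cvgM; first by apply: cvgM; [exact: cvg_cst|exact: cvg_id].
  apply: (@continuous_comp _ _ _ (fun b : R => 2^-1 * b ^+ 2) expR); last first.
    exact: continuous_expR.
  by apply: cvgM; [exact: cvg_cst|exact: exprn_continuous].
have fn : n%:R <= f n%:R.
  rewrite /f -[leLHS]mulr1; apply: ler_pM => //; first by rewrite ler_peMl// ltW.
  by rewrite -expR0 ler_expR mulr_ge0.
have [b _ fb] : exists2 b, b \in `[0, n%:R] & f b = n%:R.
  apply: IVT => //; first exact: continuous_subspaceT.
  rewrite {1 3}/f mulr0 mul0r.
  by rewrite minEle maxEle (le_trans (ltW nR) fn) ltW.
have pos c : f c = n%:R -> 0 < c.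
  move=> fcn; rewrite ltNge; apply/negP => c0.
  move: nR; rewrite -fcn ltNge => /negP; apply.
  by rewrite /f mulr_le0_ge0 ?expR_ge0// mulr_ge0_le0// ltW.
have mono x y : 0 < x -> x < y -> f x < f y.
  move=> x0 xy; rewrite /f; apply: ltr_pM; rewrite ?mulr_ge0 ?expR_ge0 ?(ltW s0) ?(ltW x0)//.
    by rewrite ltr_pM2l.
  by rewrite ltr_expR ltr_pM2l// ltrXn2r ?(ltW x0) ?(ltW (lt_trans x0 xy)).
exists b; split => // c fcn.
have [/(mono _ _ (pos _ fb))|/(mono _ _ (pos _ fcn))|//] := ltgtP b c.
  by rewrite fb [f c]fcn ltxx.
by rewrite fb [f c]fcn ltxx.
Qed.

(* Main.v *)
(* Write [e = 1 / b_n ^ 2], which is of order [1 / log n], [y = b_n + x / b_n]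
   and [t = n (1 - F_lambda y)].  By the choice of [b_n], the Mills bound
   [2 n phi(y) / y] equals [exp (- x) * exp (- x ^ 2 e / 2) / (1 + x e)] exactly.

   Lower bound, with a constant free of [lambda]: since [Phi <= 1], [1 - F_lambda]
   is at most the tail [2 (1 - Phi)] of the half-normal law.  At [x = 1] this
   gives [t <= exp (- 1) / (1 + e)], so [F_lambda^n] exceeds [Lambda 1] by at
   least a fixed multiple of [e].

   Upper bound: Mills' lower bound and [Phi (lambda y) = 1 - O(1 / y ^ 2)] give
   [t = exp (- x) (1 + O((1 + x ^ 2) e))] for [x >= - b_n / 4], whereas
   [(1 - t / n) ^ n] differs from [exp (- t)] by [O(1 / n)].  Further to the left,
   monotonicity is enough.  The finitely many [n] for which [b_n] is small are
   absorbed in the constant, as the distance is at most 1. *)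

Require Import Defs.
From HB Require Import structures.
From mathcomp Require Import all_boot all_order all_algebra.
From mathcomp Require Import all_classical all_reals all_analysis.
From mathcomp Require Import measurable_realfun ring lra.
Import Order.TTheory GRing.Theory Num.Theory.
Import numFieldNormedType.Exports.

Local Open Scope classical_set_scope.
Local Open Scope ring_scope.

(** * The standard normal law *)

(** The half-lines share the point [y], which has measure zero; closing both at [y] fits the
    distribution functions and the tails alike. *)
Lemma Rintegral_split_at {R : realType} (f : R -> R) (y : R) :
  (@lebesgue_measure R).-integrable setT (EFin \o f) ->
  \int[lebesgue_measure]_t f t =
  \int[lebesgue_measure]_(t in `]-oo, y]) f t +
  \int[lebesgue_measure]_(t in `[y, +oo[) f t.
Proof.
move=> intf; rewrite -(@Rintegral_itv_obnd_cbnd _ y +oo%O).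
  by rewrite -(@Rintegral_itvB _ f -oo%O +oo%O) ?set_itvNyy// subrKC.
exact: integrableS intf.
Qed.

(** The constant [sqrt (2 pi)] is written [2 * sqrt (pi / 2)] so that it cancels against the factor
    in [norming_eq]. *)
Lemma std_normal_pdfE {R : realType} (x : R) :
  std_normal_pdf x = (2 * Num.sqrt (pi / 2))^-1 * expR (- (x ^+ 2 / 2)).
Proof.
rewrite /std_normal_pdf normal_pdfE ?oner_eq0// /normal_fun /normal_peak.
congr (_^-1 * expR _); last by rewrite subr0 expr1n mulNr.
rewrite expr1n mul1r -[in LHS]mulr_natr.
rewrite (_ : pi * 2 = 2 ^+ 2 * (pi / 2)); last by field.
by rewrite sqrtrM ?exprn_ge0// sqrtr_sqr ger0_norm.
Qed.

Lemma sqrt_half_pi_ge1 {R : realType} : 1 <= Num.sqrt (pi / 2) :> R.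
Proof. by rewrite -[leLHS]sqrtr1 ler_wsqrtr// ler_pdivlMr// mul1r pi_ge2. Qed.

Lemma std_normal_pdf_ge0 {R : realType} (x : R) : 0 <= std_normal_pdf x.
Proof. exact: normal_pdf_ge0. Qed.

Lemma std_normal_pdf_le1 {R : realType} (x : R) : std_normal_pdf x <= 1.
Proof.
rewrite std_normal_pdfE mulr_ile1 ?expR_ge0 ?invr_ge0 ?mulr_ge0 ?sqrtr_ge0//.
  by rewrite invf_le1 ?(le_trans sqrt_half_pi_ge1) ?ler_peMl ?sqrtr_ge0 ?ler1n//;
     rewrite mulr_gt0 ?(lt_le_trans ltr01 sqrt_half_pi_ge1).
by rewrite expR_le1 oppr_le0 divr_ge0 ?sqr_ge0.
Qed.

Lemma std_normal_pdfN {R : realType} (x : R) :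
  std_normal_pdf (- x) = std_normal_pdf x.
Proof. by rewrite !std_normal_pdfE sqrrN. Qed.

Lemma continuous_std_normal_pdf {R : realType} : continuous (@std_normal_pdf R).
Proof. by apply: continuous_normal_pdf; rewrite oner_eq0. Qed.

Lemma integrable_std_normal_pdf {R : realType} {D : set R} : measurable D ->
  lebesgue_measure.-integrable D (EFin \o @std_normal_pdf R).
Proof.
by move=> mD; apply: integrableS (integrable_normal_pdf 0 1).
Qed.

Lemma Rintegral_std_normal_pdf {R : realType} :
  \int[lebesgue_measure]_t @std_normal_pdf R t = 1.
Proof. by rewrite /Rintegral integral_normal_pdf. Qed.

Definition std_normal_tail {R : realType} (x : R) : R :=
  \int[lebesgue_measure]_(t in `[x, +oo[) std_normal_pdf t.

Lemma std_normal_cdf_tail {R : realType} (x : R) :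
  std_normal_cdf x + std_normal_tail x = 1.
Proof.
by rewrite -Rintegral_split_at ?Rintegral_std_normal_pdf//;
   exact: integrable_std_normal_pdf.
Qed.

Lemma std_normal_cdfN {R : realType} (x : R) :
  std_normal_cdf (- x) = std_normal_tail x.
Proof.
rewrite /std_normal_cdf /std_normal_tail /Rintegral.
rewrite ge0_integration_by_substitutionNy; last 2 first.
- exact/continuous_subspaceT/continuous_std_normal_pdf.
- by move=> t _; exact: std_normal_pdf_ge0.
by congr fine; apply: eq_integral => t _ /=; rewrite std_normal_pdfN.
Qed.

Lemma std_normal_tail_ge0 {R : realType} (x : R) : 0 <= std_normal_tail x.
Proof. by apply: Rintegral_ge0 => t _; exact: std_normal_pdf_ge0. Qed.

Lemma std_normal_cdf_ge0 {R : realType} (x : R) : 0 <= std_normal_cdf x.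
Proof. by apply: Rintegral_ge0 => t _; exact: std_normal_pdf_ge0. Qed.

Lemma std_normal_cdf_le1 {R : realType} (x : R) : std_normal_cdf x <= 1.
Proof. by rewrite -(std_normal_cdf_tail x) lerDl std_normal_tail_ge0. Qed.

Lemma continuous_std_normal_cdf {R : realType} : continuous (@std_normal_cdf R).
Proof.
move=> x; apply/differentiable_continuous/derivable1_diffP.
(* Any point to the right of [x] would do: it makes [x] interior to the half-line on which the
   fundamental theorem of calculus is applied. *)
have xx1 : x < x + 1 by rewrite ltrDl.
have intf := integrable_std_normal_pdf (measurable_itv `]-oo, x + 1]).
have cpdf := @continuous_std_normal_pdf R x.
by have [] := continuous_FTC1 xx1 intf _ cpdf; rewrite ?ltNyr ?bnd_simp.
Qed.

(** * Mills' bounds for the normal tail *)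

Lemma is_derive_std_normal_pdf {R : realType} (t : R) :
  is_derive t 1 (@std_normal_pdf R) (- t * std_normal_pdf t).
Proof.
pose c : R := (2 * Num.sqrt (pi / 2))^-1.
pose q : R -> R := - 2^-1 \*: (@id R ^+ 2).
have -> : @std_normal_pdf R = c \*: (expR \o q).
  apply/funext => s; rewrite std_normal_pdfE /q /c /=.
  by congr (_ * expR _); rewrite /= /GRing.scale /= -[(id ^+ 2) s]/(s ^+ 2); field.
have dq : is_derive t 1 q (- t).
  have := @is_deriveZ _ _ _ _ (- 2^-1) t 1 _
    (@is_deriveX _ _ (@id R) 2 t 1 1 (is_derive_id t 1)).
  move=> h; by apply: (is_derive_eq h); rewrite /GRing.scale /= expr1; lra.
have := is_deriveZ c (is_derive1_comp (is_derive_expR (q t)) dq).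
by move=> h; apply: (is_derive_eq h); rewrite /= /GRing.scale /=; ring.
Qed.

(** Since [phi' (t) = - t phi (t)], differentiating the numerator gives back [phi], and the
    denominator contributes [phi (t) / t ^ 2]. *)
Lemma is_derive_mills {R : realType} (t : R) : 0 < t ->
  is_derive t 1 (fun s : R => - (std_normal_pdf s / s))
    (std_normal_pdf t * (1 + (t ^+ 2)^-1)).
Proof.
move=> t0; have tn0 : t != 0 by rewrite gt_eqF.
have dV := is_deriveV tn0 (is_derive_id t 1).
have := is_deriveN (is_deriveM (is_derive_std_normal_pdf t) dV).
by move=> h; apply: (is_derive_eq h); rewrite /GRing.scale /=; field.
Qed.

Lemma continuous_within_mills {R : realType} (y : R) : 0 < y ->
  {within `[y, +oo[, continuous
    (fun t : R => std_normal_pdf t * (1 + (t ^+ 2)^-1))}.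
Proof.
move=> y0.
apply: continuous_in_subspaceT => t; rewrite inE/= in_itv/= andbT => yt.
apply: cvgM; first exact: continuous_std_normal_pdf.
apply: cvgD; first exact: cvg_cst.
apply: cvgV; first by rewrite expf_eq0/= gt_eqF// (lt_le_trans y0).
exact: exprn_continuous.
Qed.

Lemma integrable_mills {R : realType} (y : R) : 0 < y ->
  lebesgue_measure.-integrable `[y, +oo[
    (EFin \o (fun t : R => std_normal_pdf t * (1 + (t ^+ 2)^-1))).
Proof.
move=> y0; have intphi := integrable_std_normal_pdf (measurable_itv `[y, +oo[).
apply: (le_integrable _ _ _ (integrableZl _ (1 + (y ^+ 2)^-1) intphi)) => //=.
  apply/measurable_EFinP; apply: subspace_continuous_measurable_fun => //.
  exact: continuous_within_mills.
move=> t; rewrite in_itv/= andbT => yt; have t0 := lt_le_trans y0 yt.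
rewrite lee_fin !ger0_norm ?mulr_ge0 ?addr_ge0 ?invr_ge0 ?sqr_ge0
  ?std_normal_pdf_ge0 //.
rewrite mulrC ler_wpM2r ?std_normal_pdf_ge0// lerD2l lef_pV2 ?posrE ?exprn_gt0//.
by rewrite lerXn2r// nnegrE ltW.
Qed.

(* As [1 <= 1 + 1 / t ^ 2 <= 1 + 1 / y ^ 2] for [t >= y], this one integral
   yields both Mills bounds. *)
Lemma Rintegral_mills {R : realType} (y : R) : 0 < y ->
  \int[lebesgue_measure]_(t in `[y, +oo[)
    (std_normal_pdf t * (1 + (t ^+ 2)^-1)) = std_normal_pdf y / y.
Proof.
move=> y0.
have dm (t : R) : 0 < t -> is_derive t 1 (fun s : R => - (std_normal_pdf s / s))
    (std_normal_pdf t * (1 + (t ^+ 2)^-1)) by exact: is_derive_mills.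
rewrite (@Rintegral_ge0_continuous_FTC2y _ _ (fun s : R => - (std_normal_pdf s / s)) y 0).
- by rewrite opprK add0r.
- by move=> t _; rewrite mulr_ge0 ?std_normal_pdf_ge0// addr_ge0 ?invr_ge0 ?sqr_ge0.
- apply: continuous_in_subspaceT => t; rewrite inE/= in_itv/= andbT => yt.
  apply: cvgM; first exact: continuous_std_normal_pdf.
  apply: cvgD; first exact: cvg_cst.
  apply: cvgV; first by rewrite expf_eq0/= gt_eqF// (lt_le_trans y0).
  exact: exprn_continuous.
(* The antiderivative vanishes at infinity, because [0 <= phi (t) / t <= 1 / t]. *)
- rewrite -oppr0; apply: cvgN.
  apply: (@squeeze_cvgr _ _ _ _ (cst 0) (fun t : R => t^-1)).
  + near=> t; have t0 : 0 < t by near: t; exact: nbhs_pinfty_gt.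
    have V0 : 0 <= t^-1 by rewrite invr_ge0 ltW.
    by rewrite mulr_ge0 ?std_normal_pdf_ge0//= ler_piMl// std_normal_pdf_le1.
  + exact: cvg_cst.
  + by apply/gtr0_cvgV0; [near=> t; near: t; exact: nbhs_pinfty_gt|exact: cvg_id].
- by move=> t yt; apply: ex_derive; apply: dm; exact: lt_trans yt.
- apply: cvg_at_right_filter.
  suff: {for y, continuous (fun s : R => - (std_normal_pdf s / s))} by [].
  apply/differentiable_continuous/derivable1_diffP.
  by apply: ex_derive; exact: dm.
- move=> t; rewrite in_itv/= andbT => yt.
  by rewrite derive1E; apply: derive_val; apply: dm; exact: lt_trans yt.
Unshelve. all: by end_near.
Qed.

Lemma std_normal_tail_upper {R : realType} (y : R) : 0 < y ->
  std_normal_tail y <= std_normal_pdf y / y.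
Proof.
move=> y0; rewrite -Rintegral_mills// le_Rintegral//.
- exact: integrable_std_normal_pdf.
- exact: integrable_mills.
- by move=> t _; rewrite ler_peMr ?std_normal_pdf_ge0// lerDl invr_ge0 sqr_ge0.
Qed.

Lemma std_normal_tail_lower {R : realType} (y : R) : 0 < y ->
  std_normal_pdf y / y <= (1 + (y ^+ 2)^-1) * std_normal_tail y.
Proof.
move=> y0; rewrite -Rintegral_mills// /std_normal_tail -RintegralZl//; last first.
  exact: integrable_std_normal_pdf.
rewrite le_Rintegral//.
- exact: integrable_mills.
- exact: (integrableZl _ _ (integrable_std_normal_pdf (measurable_itv `[y, +oo[))).
- move=> t; rewrite /= in_itv/= andbT => yt; have t0 := lt_le_trans y0 yt.
  rewrite mulrC ler_wpM2r ?std_normal_pdf_ge0// lerD2l lef_pV2 ?posrE ?exprn_gt0//.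
  by rewrite lerXn2r// nnegrE ltW.
Qed.

(** * The skew-normal law and its tail *)

Lemma skew_normal_pdf_ge0 {R : realType} (lambda x : R) :
  0 <= skew_normal_pdf lambda x.
Proof. by rewrite !mulr_ge0 ?std_normal_pdf_ge0 ?std_normal_cdf_ge0. Qed.

Lemma skew_normal_pdf_le {R : realType} (lambda x : R) :
  skew_normal_pdf lambda x <= 2 * std_normal_pdf x.
Proof. by rewrite ler_piMr ?std_normal_cdf_le1// mulr_ge0 ?std_normal_pdf_ge0. Qed.

Lemma continuous_skew_normal_pdf {R : realType} (lambda : R) :
  continuous (skew_normal_pdf lambda).
Proof.
move=> x; apply: cvgM.
  by apply: cvgM; [exact: cvg_cst|exact: continuous_std_normal_pdf].
apply: (@continuous_comp _ _ _ (fun t : R => lambda * t) std_normal_cdf).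
  by apply: cvgM; [exact: cvg_cst|exact: cvg_id].
exact: continuous_std_normal_cdf.
Qed.

Lemma integrable_skew_normal_pdf {R : realType} (lambda : R) {D : set R} :
  measurable D ->
  lebesgue_measure.-integrable D (EFin \o skew_normal_pdf lambda).
Proof.
move=> mD; have intphi := integrable_std_normal_pdf mD.
apply: (le_integrable _ _ _ (integrableZl _ 2 intphi)) => //=.
  apply/measurable_EFinP; apply: measurable_funTS; apply: continuous_measurable_fun.
  exact: continuous_skew_normal_pdf.
move=> t _; rewrite lee_fin !ger0_norm ?mulr_ge0 ?std_normal_pdf_ge0//.
  exact: skew_normal_pdf_le.
exact: std_normal_cdf_ge0.
Qed.

(* The density at [- t] is [2 phi(t) (1 - Phi(lambda t))], so the two half-lines
   together carry the mass of [2 phi] over one of them. *)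
Lemma Rintegral_skew_normal_pdf {R : realType} (lambda : R) :
  \int[lebesgue_measure]_t skew_normal_pdf lambda t = 1.
Proof.
have reflect0 (f : R -> R) : continuous f -> (forall t, 0 <= f t) ->
    \int[lebesgue_measure]_(t in `]-oo, 0]) f t =
    \int[lebesgue_measure]_(t in `[0, +oo[) f (- t).
  (* The endpoint [0] becomes [- 0], the shape required by the substitution of [- t] for [t]. *)
  move=> cf f0; rewrite /Rintegral -[in LHS]oppr0.
  rewrite ge0_integration_by_substitutionNy//.
  exact/continuous_subspaceT.
have m0 := measurable_itv `[(0 : R), +oo[.
have ints := integrable_skew_normal_pdf lambda.
have intn : lebesgue_measure.-integrable `[0, +oo[
    (EFin \o (fun t : R => skew_normal_pdf lambda (- t))).
  apply: (le_integrable _ _ _ (integrableZl _ 2 (integrable_std_normal_pdf m0))) => //=.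
    apply/measurable_EFinP; apply: measurable_funTS.
    apply: continuous_measurable_fun => x.
    apply: (@continuous_comp _ _ _ -%R (skew_normal_pdf lambda)).
      exact: oppr_continuous.
    exact: continuous_skew_normal_pdf.
  move=> t _; rewrite lee_fin !ger0_norm ?mulr_ge0 ?std_normal_pdf_ge0//.
    by rewrite (le_trans (skew_normal_pdf_le _ _))// std_normal_pdfN.
  exact: std_normal_cdf_ge0.
rewrite (@Rintegral_split_at _ _ 0)//; last exact: ints.
rewrite reflect0; [|exact: continuous_skew_normal_pdf|exact: skew_normal_pdf_ge0].
rewrite -RintegralD//; last exact: ints.
rewrite -Rintegral_std_normal_pdf (@Rintegral_split_at _ std_normal_pdf 0); last first.
  exact: integrable_std_normal_pdf.
rewrite reflect0; [|exact: continuous_std_normal_pdf|exact: std_normal_pdf_ge0].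
rewrite -RintegralD//; last 2 first.
- apply: eq_integrable (integrable_std_normal_pdf m0) => // t _ /=.
  by rewrite std_normal_pdfN.
- exact: integrable_std_normal_pdf.
apply: eq_Rintegral => t _; rewrite /skew_normal_pdf !std_normal_pdfN mulrN.
rewrite std_normal_cdfN; have := std_normal_cdf_tail (lambda * t).
by move=> /(canRL (addKr _)) ->; ring.
Qed.

Definition skew_normal_tail {R : realType} (lambda y : R) : R :=
  \int[lebesgue_measure]_(t in `[y, +oo[) skew_normal_pdf lambda t.

Lemma skew_normal_cdf_tail {R : realType} (lambda y : R) :
  skew_normal_cdf lambda y = 1 - skew_normal_tail lambda y.
Proof.
rewrite -(Rintegral_skew_normal_pdf lambda) (@Rintegral_split_at _ _ y) ?addrK//.
exact: integrable_skew_normal_pdf.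
Qed.

Lemma skew_normal_cdf_ge0 {R : realType} (lambda y : R) :
  0 <= skew_normal_cdf lambda y.
Proof. by apply: Rintegral_ge0 => t _; exact: skew_normal_pdf_ge0. Qed.

Lemma skew_normal_tail_ge0 {R : realType} (lambda y : R) :
  0 <= skew_normal_tail lambda y.
Proof. by apply: Rintegral_ge0 => t _; exact: skew_normal_pdf_ge0. Qed.

Lemma skew_normal_cdf_le1 {R : realType} (lambda y : R) :
  skew_normal_cdf lambda y <= 1.
Proof. by rewrite skew_normal_cdf_tail gerBl skew_normal_tail_ge0. Qed.

Lemma skew_normal_cdf_nondecreasing {R : realType} (lambda : R) :
  {homo skew_normal_cdf lambda : x y / x <= y}.
Proof.
move=> x y xy; have int D := @integrable_skew_normal_pdf R lambda D.
rewrite -subr_ge0 /skew_normal_cdf Rintegral_itvB ?bnd_simp//; last exact: int.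
by apply: Rintegral_ge0 => t _; exact: skew_normal_pdf_ge0.
Qed.

Lemma std_normal_cdf_nondecreasing {R : realType} :
  {homo @std_normal_cdf R : x y / x <= y}.
Proof.
move=> x y xy.
rewrite -subr_ge0 /std_normal_cdf Rintegral_itvB ?bnd_simp//.
  by apply: Rintegral_ge0 => t _; exact: std_normal_pdf_ge0.
exact: integrable_std_normal_pdf.
Qed.

Lemma skew_normal_tail_le {R : realType} (lambda y : R) :
  skew_normal_tail lambda y <= 2 * std_normal_tail y.
Proof.
have int := integrable_std_normal_pdf (measurable_itv `[y, +oo[).
rewrite -RintegralZl// le_Rintegral//.
- exact: integrable_skew_normal_pdf.
- exact: (integrableZl _ 2 int).
- by move=> t _; exact: skew_normal_pdf_le.
Qed.

(** For [t >= y] and [lambda > 0], monotonicity gives [Phi (lambda t) >= Phi (lambda y)], and this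
    constant comes out of the integral. *)
Lemma skew_normal_tail_ge {R : realType} (lambda y : R) : 0 < lambda ->
  std_normal_cdf (lambda * y) * (2 * std_normal_tail y) <=
  skew_normal_tail lambda y.
Proof.
move=> l0; have int := integrable_std_normal_pdf (measurable_itv `[y, +oo[).
rewrite mulrA -RintegralZl// le_Rintegral//.
- exact: (integrableZl _ _ int).
- exact: integrable_skew_normal_pdf.
- move=> t; rewrite /= in_itv/= andbT => yt.
  rewrite -mulrA mulrC ler_wpM2l ?mulr_ge0 ?std_normal_pdf_ge0//.
  by apply: std_normal_cdf_nondecreasing; rewrite ler_pM2l.
Qed.

(** * Elementary estimates for exponentials and powers *)

Lemma sqrt_half_pi_le2 {R : realType} : Num.sqrt (pi / 2) <= 2 :> R.
Proof.
rewrite -[leRHS](@ger0_norm R)// -sqrtr_sqr ler_wsqrtr//.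
by have := pihalf_lt2 R; lra.
Qed.

(** Follows from [1 / (1 - p) = 1 + p / (1 - p) <= exp (p / (1 - p))], inverted and raised to the
    power [n]. *)
Lemma expr_onem_ge {R : realType} (p : R) (n : nat) : 0 <= p < 1 ->
  expR (- (n%:R * (p / (1 - p)))) <= (1 - p) ^+ n.
Proof.
move=> /andP[p0 p1]; have q0 : 0 < 1 - p by rewrite subr_gt0.
rewrite -mulrN expRM_natl lerXn2r ?nnegrE ?expR_ge0 ?(ltW q0)//.
rewrite expRN invf_ple ?posrE ?expR_gt0//.
rewrite (le_trans _ (expR_ge1Dx _))// [leLHS](_ : _ = 1 + p / (1 - p))//.
by field; rewrite gt_eqF.
Qed.

Lemma expr_onem_le {R : realType} (p : R) (n : nat) : p <= 1 ->
  (1 - p) ^+ n <= expR (- (n%:R * p)).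
Proof.
move=> p1; rewrite -mulrN expRM_natl lerXn2r ?nnegrE ?expR_ge0 ?subr_ge0//.
exact: expR_ge1Dx.
Qed.

(** On the half-line from [m] on, [exp (- t)] is Lipschitz with constant [exp (- m)]. *)
Lemma expRN_dist {R : realType} (m t u : R) : m <= t -> m <= u ->
  `|expR (- t) - expR (- u)| <= expR (- m) * `|t - u|.
Proof.
wlog tu : t u / t <= u => [H mt mu|mt _].
  have [tu|/ltW ut] := leP t u; first exact: H.
  by rewrite distrC [`|t - u|]distrC; exact: H.
rewrite ger0_norm ?subr_ge0 ?ler_expR ?lerN2// distrC ger0_norm ?subr_ge0//.
have -> : expR (- t) - expR (- u) = expR (- t) * (1 - expR (- (u - t))).
  by rewrite mulrBr mulr1 -expRD; congr (_ - expR _); ring.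
rewrite ler_pM ?expR_ge0 ?subr_ge0//.
- by rewrite -expR0 ler_expR oppr_le0 subr_ge0.
- by rewrite ler_expR lerN2.
- by have := expR_ge1Dx (- (u - t)); lra.
Qed.

(** [v ^ n / n!] is one term of the series of [exp v]. This absorbs polynomial factors into a
    decaying exponential. *)
Lemma exprn_expRN_le {R : realType} (v : R) (n : nat) : 0 <= v ->
  v ^+ n * expR (- v) <= n`!%:R.
Proof.
move=> v0; rewrite expRN ler_pdivrMr ?expR_gt0//.
case: n => [|n]; first by rewrite expr0 mul1r (le_trans _ (expR_ge1Dx _))// lerDl.
rewrite mulrC -ler_pdivrMr ?ltr0n ?fact_gt0//.
by rewrite (le_trans _ (expR_ge1Dxn n v0))// lerDr.
Qed.

(** With [t = n p], the power lies between [exp (- t / (1 - p))] and [exp (- t)]. The exponents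
    differ by [t ^ 2 / (n (1 - p)) <= 2 t ^ 2 / n], and [t ^ 2 exp (- t) <= 2]. *)
Lemma expr_onem_expRN_dist {R : realType} (p : R) (n : nat) : (0 < n)%N ->
  0 <= p <= 2^-1 ->
  `|(1 - p) ^+ n - expR (- (n%:R * p))| <= 4 / n%:R.
Proof.
move=> n0 /andP[p0 p2]; have nR : 0 < n%:R :> R by rewrite ltr0n.
have q0 : 0 < 1 - p by lra.
rewrite distrC ger0_norm ?subr_ge0 ?expr_onem_le//; last lra.
have [t tE] : exists t, t = n%:R * p by exists (n%:R * p).
rewrite -tE; have t0 : 0 <= t by rewrite tE mulr_ge0// ltW.
have lo : expR (- (n%:R * (p / (1 - p)))) <= (1 - p) ^+ n.
  by rewrite expr_onem_ge// p0 /=; lra.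
have tt : t <= n%:R * (p / (1 - p)).
  by rewrite tE ler_pM2l// ler_pdivlMr// ler_piMr//; lra.
have := expRN_dist t t (n%:R * (p / (1 - p))) (lexx _) tt.
rewrite ger0_norm ?subr_ge0 ?ler_expR ?lerN2// distrC ger0_norm ?subr_ge0// => h.
apply: (@le_trans _ _ (expR (- t) * (n%:R * (p / (1 - p)) - t))); first lra.
have -> : n%:R * (p / (1 - p)) - t = t ^+ 2 / n%:R / (1 - p).
  by rewrite tE; field; rewrite !gt_eqF.
have h2 := exprn_expRN_le t 2 t0.
rewrite !mulrA ler_pdivrMr// [leRHS]mulrAC ler_pM2r ?invr_gt0//.
by rewrite mulrC; move: h2; rewrite (_ : 2`! = 2%N)//; lra.
Qed.

(** * The norming constants [b_n] *)

(** In [(b + x / b) ^ 2 / 2 = b ^ 2 / 2 + x + x ^ 2 / (2 b ^ 2)] the first term is cancelled by the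
    exponential in [norming_eq]; the remaining [b / (b + x / b)] is [1 / (1 + x / b ^ 2)]. *)
Lemma norming_eq_tail {R : realType} (n : nat) (b x : R) :
  0 < b -> 0 < b + x / b -> norming_eq n b ->
  n%:R * (2 * (std_normal_pdf (b + x / b) / (b + x / b))) =
  expR (- x) * (expR (- (x ^+ 2 / b ^+ 2 / 2)) / (1 + x / b ^+ 2)).
Proof.
move=> b0 y0 <-; rewrite std_normal_pdfE.
have s0 : 0 < Num.sqrt (pi / 2) :> R by exact: lt_le_trans sqrt_half_pi_ge1.
have -> : expR (- ((b + x / b) ^+ 2 / 2)) =
    (expR (2^-1 * b ^+ 2))^-1 * expR (- x) * expR (- (x ^+ 2 / b ^+ 2 / 2)).
  by rewrite -expRN -!expRD; congr expR; field; rewrite gt_eqF.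
have e0 := expR_gt0 (2^-1 * b ^+ 2).
have d0 : 0 < b ^+ 2 + x.
  by have := mulr_gt0 b0 y0; rewrite mulrDr mulrCA divff ?gt_eqF// mulr1 expr2.
by field; rewrite !gt_eqF.
Qed.

Lemma norming_eq_gt0 {R : realType} (n : nat) (b : R) :
  (0 < n)%N -> norming_eq n b -> 0 < b.
Proof.
move=> n0 nb; rewrite ltNge; apply/negP => b0.
have : 0 < n%:R :> R by rewrite ltr0n.
rewrite -nb ltNge => /negP; apply.
by rewrite mulr_le0_ge0 ?expR_ge0// mulr_ge0_le0// sqrtr_ge0.
Qed.

(** If [b < 1], the three factors of [norming_eq] are at most 2, 1 and 2, so that [n <= 4]. *)
Lemma norming_eq_ge1 {R : realType} (n : nat) (b : R) :
  (9 <= n)%N -> norming_eq n b -> 1 <= b.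
Proof.
move=> n9 nb; have b0 : 0 < b by apply: norming_eq_gt0 nb; exact: leq_trans n9.
rewrite leNgt; apply/negP => b1.
have e2 : expR (2^-1 * b ^+ 2) <= 2.
  have b2 : b ^+ 2 <= 1 by rewrite exprn_ile1// ltW.
  rewrite -[leLHS]invrK -expRN invf_ple ?posrE ?expR_gt0//.
  by rewrite (le_trans _ (expR_ge1Dx _))//; lra.
have : n%:R < 9 :> R.
  rewrite -nb (@le_lt_trans _ _ (2 * 1 * 2))//; last lra.
  by rewrite !ler_pM ?mulr_ge0 ?sqrtr_ge0 ?expR_ge0 ?sqrt_half_pi_le2// ltW.
by rewrite ltr_nat ltnNge n9.
Qed.

(** Rests on [exp (b ^ 2 / 2) >= 1 + b ^ 2 / 2 >= b]. It turns errors of order [1 / n] into errors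
    of order [1 / b ^ 2]. *)
Lemma norming_eq_sqr_le {R : realType} (n : nat) (b : R) :
  0 < b -> norming_eq n b -> b ^+ 2 <= n%:R.
Proof.
move=> b0 <-; have e := expR_ge1Dx (2^-1 * b ^+ 2).
rewrite -mulrA -[leLHS]mul1r ler_pM ?sqr_ge0 ?sqrt_half_pi_ge1//.
rewrite expr2 ler_pM2l// (le_trans _ e)//.
by have := sqr_ge0 (b - 1); nra.
Qed.

(** Translates the rate [1 / b_n ^ 2] into [1 / log n]. After exponentiation, the left bound holds
    because [sqrt (pi / 2) * b >= 1]. *)
Lemma norming_eq_ln {R : realType} (n : nat) (b : R) :
  1 <= b -> norming_eq n b -> b ^+ 2 / 2 <= ln n%:R <= 3 * b ^+ 2.
Proof.
move=> b1 nb; have b0 : 0 < b by exact: lt_le_trans b1.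
have nR : 0 < n%:R :> R.
  by rewrite (lt_le_trans _ (norming_eq_sqr_le _ _ b0 nb)) ?exprn_gt0.
have s1 := @sqrt_half_pi_ge1 R.
have bb : b <= b ^+ 2 by rewrite expr2 ler_peMl// ltW.
rewrite -ler_expR -[X in _ && X]ler_expR !lnK ?posrE// -nb; apply/andP; split.
  rewrite mulrC -[leLHS]mul1r ler_pM// ?expR_ge0//.
  by rewrite -[leLHS]mulr1 ler_pM.
(* One copy of [b ^ 2] for each factor of [norming_eq]: each is at most [exp (b ^ 2)]. *)
have -> : 3 * b ^+ 2 = b ^+ 2 + b ^+ 2 + b ^+ 2 by ring.
rewrite !expRD !ler_pM ?mulr_ge0 ?sqrtr_ge0 ?expR_ge0// ?(ltW b0)//.
- rewrite (le_trans sqrt_half_pi_le2)// (le_trans _ (expR_ge1Dx _))//.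
  by have := exprn_ege1 2 b1; lra.
- by rewrite (le_trans bb)// (le_trans _ (expR_ge1Dx _))// lerDr.
- by rewrite ler_expR; have := sqr_ge0 b; lra.
Qed.

(** * Comparison of [exp (- t)] with the Gumbel law *)

(* For [e = 1 / b_n ^ 2], the ratio of Mills' bound [2 n phi(y) / y] to
   [exp (- x)], by [norming_eq_tail]. *)
Definition gumbel_factor {R : realType} (e x : R) : R :=
  expR (- (x ^+ 2 * e / 2)) / (1 + x * e).

(** For [u = exp (- x)], the hypotheses give [0 <= u - t <= u (x ^ 2 / 2 + x + k) e]. As [exp (- t)]
    is 1-Lipschitz for [t >= 0], the constant [2 + k] comes from [x ^ 2 u <= 2], [x u <= 1] and
    [u <= 1]. *)
Lemma gumbel_near_right {R : realType} (e k x t : R) :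
  0 <= e -> 0 <= k -> k * e <= 1 -> 0 <= x ->
  expR (- x) * gumbel_factor e x * (1 - k * e) <= t ->
  t <= expR (- x) * gumbel_factor e x ->
  `|expR (- t) - gumbel_cdf x| <= (2 + k) * e.
Proof.
move=> e0 k0 ke1 x0 tlo tup; rewrite /gumbel_cdf.
have xe0 : 0 <= x * e by rewrite mulr_ge0.
have d0 : 0 < 1 + x * e by lra.
have u0 := expR_gt0 (- x); set u := expR (- x) in tlo tup u0 *.
set A := gumbel_factor e x in tlo tup *.
have A0 : 0 <= A by rewrite divr_ge0 ?expR_ge0// ltW.
have A1 : A <= 1.
  rewrite ler_pdivrMr// mul1r (@le_trans _ _ 1)//; last lra.
  by rewrite expR_le1 oppr_le0 divr_ge0 ?mulr_ge0 ?sqr_ge0.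
(* With [q = x ^ 2 e / 2], this is [(1 - q - x e) (1 + x e) <= 1 - q <= exp (- q)]. *)
have Alo : 1 - (x ^+ 2 / 2 + x) * e <= A.
  have := expR_ge1Dx (- (x ^+ 2 * e / 2)).
  have q0 : 0 <= x ^+ 2 * e / 2 by rewrite divr_ge0 ?mulr_ge0 ?sqr_ge0.
  rewrite ler_pdivlMr//; apply: le_trans.
  have := mulr_ge0 xe0 xe0; have := mulr_ge0 xe0 q0; nra.
have x1 : x * u <= 1 by have := exprn_expRN_le x 1 x0.
have x2 : x ^+ 2 * u <= 2 by have := exprn_expRN_le x 2 x0.
have u1 : u <= 1 by rewrite expR_le1 oppr_le0.
clearbody u A.
have t0 : 0 <= t.
  by rewrite (le_trans _ tlo)// mulr_ge0 ?mulr_ge0 ?(ltW u0)//; lra.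
apply: le_trans (expRN_dist 0 t u t0 (ltW u0)) _.
rewrite oppr0 expR0 mul1r distrC ger0_norm; last first.
  by rewrite subr_ge0 (le_trans tup)// ler_piMr// ltW.
apply: (@le_trans _ _ (u * (x ^+ 2 / 2 + x + k) * e)); last first.
  rewrite ler_wpM2r//; have := ler_wpM2r k0 u1; lra.
have Ak : A * (k * e) <= k * e by rewrite ler_piMl// mulr_ge0.
have : u * (1 - (x ^+ 2 / 2 + x + k) * e) <= t.
  by rewrite (le_trans _ tlo)// -mulrA ler_pM2l//; lra.
lra.
Qed.

(** Here [x = - z] and [u = exp z] may be large, so a constant Lipschitz bound does not suffice. The
    smallness conditions give [t >= u / 2], and the factor [exp (- u / 2)] then absorbs
    [u (2 z + z ^ 2 / 2 + k)], where [z <= u]. *)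
Lemma gumbel_near_left {R : realType} (e k z t : R) :
  0 <= e -> 0 <= k -> 0 <= z ->
  k * e <= 4^-1 -> z * e <= 4^-1 -> z ^+ 2 * e <= 4^-1 ->
  expR z * gumbel_factor e (- z) * (1 - k * e) <= t ->
  t <= expR z * gumbel_factor e (- z) ->
  `|expR (- t) - gumbel_cdf (- z)| <= (40 + 2 * k) * e.
Proof.
move=> e0 k0 z0 ke ze zze tlo tup; rewrite /gumbel_cdf opprK.
have ze0 : 0 <= z * e by rewrite mulr_ge0.
have zze0 : 0 <= z ^+ 2 * e by rewrite mulr_ge0 ?sqr_ge0.
have ke0 : 0 <= k * e by rewrite mulr_ge0.
have u0 := expR_gt0 z; have zu := expR_ge1Dx z.
set u := expR z in tlo tup u0 zu *.
set A := gumbel_factor e (- z) in tlo tup *.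
have d0 : 0 < 1 + (- z) * e by lra.
have g1 : expR (- ((- z) ^+ 2 * e / 2)) <= 1.
  by rewrite expR_le1 oppr_le0 sqrrN divr_ge0.
have glo := expR_ge1Dx (- ((- z) ^+ 2 * e / 2)).
rewrite [in X in X <= _]sqrrN in glo.
(* Uses [1 / (1 - s) <= 1 + 2 s] for [0 <= s <= 1 / 2], with [s = z e]. *)
have Aup : A <= 1 + 2 * (z * e).
  rewrite ler_pdivrMr// (le_trans g1)//.
  have := mulr_ge0 ze0 (_ : 0 <= 1 - 2 * (z * e)); nra.
have Alo : 1 - z ^+ 2 * e / 2 <= A.
  apply: (@le_trans _ _ (expR (- ((- z) ^+ 2 * e / 2)))); first lra.
  by rewrite ler_pdivlMr// ler_piMr ?expR_ge0//; lra.
clearbody u A.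
have t1 : u * (1 - (z ^+ 2 / 2 + k) * e) <= t.
  rewrite (le_trans _ tlo)// -mulrA ler_pM2l//.
  apply: (@le_trans _ _ ((1 - z ^+ 2 * e / 2) * (1 - k * e))).
    by have := mulr_ge0 zze0 ke0; lra.
  by rewrite ler_wpM2r//; lra.
have t2 : t <= u * (1 + 2 * (z * e)) by rewrite (le_trans tup)// ler_pM2l.
have tm : u / 2 <= t by rewrite (le_trans _ t1)// ler_pM2l//; lra.
have um : u / 2 <= u by lra.
apply: le_trans (expRN_dist (u / 2) t u tm um) _.
have v0 : 0 <= u / 2 by lra.
have v1 := exprn_expRN_le (u / 2) 1 v0.
have v2 := exprn_expRN_le (u / 2) 2 v0.
have v3 := exprn_expRN_le (u / 2) 3 v0.
set w := expR (- (u / 2)) in v1 v2 v3 *.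
have w0 : 0 <= w by exact: expR_ge0.
(* The terms are [8 * 2!], [4 * 3!] and [2 k * 1!] times [e]: they bound the parts that are
   quadratic, cubic and linear in [u / 2]. *)
have -> : (40 + 2 * k) * e = 16 * e + 24 * e + 2 * (k * e) by ring.
apply: (@le_trans _ _ (w * (u * (2 * u + u ^+ 2 / 2 + k) * e))).
  rewrite ler_wpM2l// ler_norml.
  have zu' : z <= u by lra.
  have zz : z ^+ 2 <= u ^+ 2 by rewrite lerXn2r ?nnegrE// ltW.
  have h1 : u * e * z <= u * e * u by rewrite ler_wpM2l// mulr_ge0// ltW.
  have h2 : u * e * z ^+ 2 <= u * e * u ^+ 2 by rewrite ler_wpM2l// mulr_ge0// ltW.
  have h3 : 0 <= u * e * u by rewrite !mulr_ge0// ltW.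
  have h4 : 0 <= u * e * u ^+ 2 by rewrite !mulr_ge0 ?sqr_ge0// ltW.
  have h5 : 0 <= u * e * k by rewrite !mulr_ge0// ltW.
  by apply/andP; split; lra.
have -> : w * (u * (2 * u + u ^+ 2 / 2 + k) * e) =
    8 * e * ((u / 2) ^+ 2 * w) + 4 * e * ((u / 2) ^+ 3 * w) +
    2 * (k * e) * ((u / 2) ^+ 1 * w).
  by field.
rewrite !lerD//.
- by rewrite -[leRHS](_ : 8 * e * 2 = _) ?ler_wpM2l// ?mulr_ge0//; ring.
- by rewrite -[leRHS](_ : 4 * e * 6 = _) ?ler_wpM2l// ?mulr_ge0//; ring.
- by rewrite ler_piMr// mulr_ge0.
Qed.

(** * Two-sided bounds for the skew-normal tail *)

(** Mills' upper bound together with [phi (y) <= exp (- y ^ 2 / 2) <= 1 / y]. At [lambda y] it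
    controls [1 - Phi (lambda y)]. *)
Lemma std_normal_tail_le_sqr {R : realType} (y : R) : 0 < y ->
  std_normal_tail y <= (y ^+ 2)^-1.
Proof.
move=> y0; apply: le_trans (std_normal_tail_upper _ y0) _.
rewrite expr2 invfM ler_wpM2r ?invr_ge0 ?(ltW y0)// std_normal_pdfE.
apply: (@le_trans _ _ (expR (- (y ^+ 2 / 2)))).
  rewrite ler_piMl ?expR_ge0// invf_le1.
    by have := @sqrt_half_pi_ge1 R; lra.
  by have := @sqrt_half_pi_ge1 R; lra.
rewrite expRN lef_pV2 ?posrE ?expR_gt0//.
rewrite (le_trans _ (expR_ge1Dx _))//.
by have := sqr_ge0 (y - 1); lra.
Qed.

(** Two relative losses add up: [1 / y ^ 2] from Mills' lower bound and [1 / (lambda y) ^ 2] from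
    [1 - Phi (lambda y)]. *)
Lemma skew_normal_tail_lower {R : realType} (lambda y : R) :
  0 < lambda -> 0 < y ->
  (1 - (1 + (lambda ^+ 2)^-1) * (y ^+ 2)^-1) * (2 * (std_normal_pdf y / y)) <=
  skew_normal_tail lambda y.
Proof.
move=> l0 y0; apply: le_trans (skew_normal_tail_ge _ _ l0).
have := std_normal_tail_upper _ y0; have := std_normal_tail_lower _ y0.
have := std_normal_tail_ge0 y.
have := std_normal_tail_le_sqr _ (mulr_gt0 l0 y0).
have /(canRL (addrK _)) -> := std_normal_cdf_tail (lambda * y).
rewrite exprMn invfM.
have : 0 <= (lambda ^+ 2)^-1 by rewrite invr_ge0 sqr_ge0.
have : 0 <= (y ^+ 2)^-1 by rewrite invr_ge0 sqr_ge0.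
move: (std_normal_tail (lambda * y)) (std_normal_tail y) (std_normal_pdf y / y).
(* [P] and [Q] stand for the normal tails at [lambda y] and [y], and [m] for Mills' bound; what
   remains is polynomial arithmetic. *)
move: ((lambda ^+ 2)^-1) ((y ^+ 2)^-1) => a w P Q m w0 a0 hP Q0 mQ Qm.
have h1 := mulr_ge0 (_ : 0 <= a * w - P) Q0.
have h2 := mulr_ge0 (mulr_ge0 a0 w0) (_ : 0 <= m - Q).
have h3 := mulr_ge0 w0 (_ : 0 <= m - Q).
rewrite !subr_ge0 in h1 h2 h3; have := h1 hP; have := h2 Qm; have := h3 Qm.
lra.
Qed.

(** As the argument is at least [b / 2], its inverse square is at most [4 / b ^ 2]; hence the factor
    4. *)
Lemma skew_normal_tail_sandwich {R : realType} (lambda b x : R) (n : nat) :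
  0 < lambda -> (0 < n)%N -> norming_eq n b -> b / 2 <= b + x / b ->
  expR (- x) * gumbel_factor (b ^+ 2)^-1 x *
    (1 - 4 * (1 + (lambda ^+ 2)^-1) * (b ^+ 2)^-1) <=
  n%:R * skew_normal_tail lambda (b + x / b) <=
  expR (- x) * gumbel_factor (b ^+ 2)^-1 x.
Proof.
move=> l0 n0 nb y2; have b0 := norming_eq_gt0 _ _ n0 nb.
have y0 : 0 < b + x / b by lra.
have nR : 0 < n%:R :> R by rewrite ltr0n.
rewrite /gumbel_factor -(norming_eq_tail _ _ _ b0 y0 nb).
have m0 : 0 <= std_normal_pdf (b + x / b) / (b + x / b).
  by rewrite divr_ge0 ?std_normal_pdf_ge0// ltW.
apply/andP; split.
  rewrite -mulrA ler_pM2l// mulrC.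
  apply: le_trans (skew_normal_tail_lower _ _ l0 y0).
  apply: ler_wpM2r; first exact: mulr_ge0.
  rewrite lerD2l lerN2 -mulrA mulrCA.
  rewrite ler_wpM2l ?addr_ge0 ?invr_ge0 ?sqr_ge0//.
  have -> : 4 * (b ^+ 2)^-1 = ((b / 2) ^+ 2)^-1 by field; rewrite gt_eqF.
  rewrite lef_pV2 ?posrE ?exprn_gt0//; last lra.
  by rewrite lerXn2r// nnegrE; lra.
rewrite ler_pM2l// (le_trans (skew_normal_tail_le _ _))// ler_pM2l//.
exact: std_normal_tail_upper.
Qed.

(** * Upper bound for the distance *)

(** The constant is 4, for replacing the power by an exponential, plus [40 + 2 k], the larger of the
    two Gumbel comparison constants. The threshold on [b] yields their smallness conditions. *)
Lemma skew_normal_pow_near {R : realType} (lambda b x : R) (n : nat) :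
  let k := 4 * (1 + (lambda ^+ 2)^-1) in
  0 < lambda -> (0 < n)%N -> norming_eq n b -> 8 + 4 * k <= b -> - (b / 4) <= x ->
  `|skew_normal_cdf lambda (b + x / b) ^+ n - gumbel_cdf x| <=
  (44 + 2 * k) * (b ^+ 2)^-1.
Proof.
move=> k l0 n0 nb bk xb; have b0 := norming_eq_gt0 _ _ n0 nb.
have k0 : 0 <= k by rewrite !mulr_ge0// addr_ge0 ?invr_ge0 ?sqr_ge0.
have xb1 : - 4^-1 <= x / b by rewrite ler_pdivlMr//; lra.
have y2 : b / 2 <= b + x / b by lra.
have y0 : 0 < b + x / b by lra.
have b20 : 0 < b ^+ 2 by rewrite exprn_gt0.
have := skew_normal_tail_sandwich _ _ _ _ l0 n0 nb y2.
rewrite -/k; set p := skew_normal_tail _ _; set e := (b ^+ 2)^-1.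
move=> /andP[tlo tup].
have e0 : 0 < e by rewrite invr_gt0.
have be : b * e <= 8^-1.
  rewrite /e expr2 invfM mulrA divff ?gt_eqF// mul1r lef_pV2 ?posrE//; lra.
have ke : k * e <= 4^-1.
  have : (8 + 4 * k) * e <= b * e by rewrite ler_pM2r.
  lra.
(* [p <= 1 / 2] holds because the normal tail is at most [2 / b <= 1 / 4]. *)
have dp : `|skew_normal_cdf lambda (b + x / b) ^+ n - expR (- (n%:R * p))| <= 4 * e.
  rewrite skew_normal_cdf_tail -/p (le_trans (expr_onem_expRN_dist _ _ n0 _))//.
    rewrite skew_normal_tail_ge0/= (le_trans (skew_normal_tail_le _ _))//.
    have := std_normal_tail_upper _ y0 => /le_trans h.
    have : std_normal_tail (b + x / b) <= (b / 2)^-1.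
      apply: h; rewrite (@le_trans _ _ (b + x / b)^-1)//.
        by rewrite ler_piMl ?std_normal_pdf_le1// invr_ge0 ltW.
      by rewrite lef_pV2 ?posrE//; lra.
    have : (b / 2)^-1 <= 4^-1 by rewrite lef_pV2 ?posrE//; lra.
    lra.
  rewrite ler_pM2l// lef_pV2 ?posrE ?ltr0n//.
  exact: norming_eq_sqr_le.
have dg : `|expR (- (n%:R * p)) - gumbel_cdf x| <= (40 + 2 * k) * e.
  have [x0|x0] := leP 0 x.
    apply: le_trans (gumbel_near_right _ _ _ _ (ltW e0) k0 _ x0 tlo tup) _; first lra.
    by rewrite ler_pM2r//; lra.
  have bbe : b ^+ 2 * e = 1 by rewrite /e divff// gt_eqF.
  have := gumbel_near_left e k (- x) (n%:R * p) (ltW e0) k0.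
  rewrite !opprK; apply => //; first lra.
  - rewrite (@le_trans _ _ (b * e))//; last lra.
    by rewrite ler_pM2r//; lra.
  - have : (- x) ^+ 2 * e <= (b / 4) ^+ 2 * e.
      by rewrite ler_pM2r// lerXn2r ?nnegrE//; lra.
    by rewrite exprMn; lra.
rewrite (le_trans (ler_distD (expR (- (n%:R * p))) _ _))//.
by rewrite (le_trans (lerD dp dg))// -mulrDl ler_pM2r//; lra.
Qed.

Lemma gumbel_cdf_nondecreasing {R : realType} :
  {homo @gumbel_cdf R : x y / x <= y}.
Proof. by move=> x y xy; rewrite ler_expR lerN2 ler_expR lerN2. Qed.

Lemma gumbel_cdf_ge0 {R : realType} (x : R) : 0 <= gumbel_cdf x.
Proof. exact: expR_ge0. Qed.

Lemma gumbel_cdf_le1 {R : realType} (x : R) : gumbel_cdf x <= 1.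
Proof. by rewrite expR_le1 oppr_le0 expR_ge0. Qed.

(* To the left of [- b / 4] both distribution functions are monotone and already
   of order [1 / b ^ 2], since [exp (- exp (b / 4))] is. *)
Lemma skew_normal_pow_dist {R : realType} (lambda b x : R) (n : nat) :
  let k := 4 * (1 + (lambda ^+ 2)^-1) in
  0 < lambda -> (0 < n)%N -> norming_eq n b -> 8 + 4 * k <= b ->
  `|skew_normal_cdf lambda (b + x / b) ^+ n - gumbel_cdf x| <=
  (76 + 2 * k) * (b ^+ 2)^-1.
Proof.
move=> k l0 n0 nb bk; have b0 := norming_eq_gt0 _ _ n0 nb.
have e0 : 0 < (b ^+ 2)^-1 by rewrite invr_gt0 exprn_gt0.
have [xb|/ltW xb] := leP (- (b / 4)) x.
  have := skew_normal_pow_near _ _ _ _ l0 n0 nb bk xb => /le_trans; apply.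
  by rewrite ler_pM2r// lerD2r ler_nat.
have := skew_normal_pow_near _ _ _ _ l0 n0 nb bk (lexx _).
have F0 y : 0 <= skew_normal_cdf lambda y ^+ n.
  by rewrite exprn_ge0// skew_normal_cdf_ge0.
have Fx : skew_normal_cdf lambda (b + x / b) ^+ n <=
    skew_normal_cdf lambda (b + - (b / 4) / b) ^+ n.
  rewrite lerXn2r ?nnegrE ?skew_normal_cdf_ge0//.
  by apply: skew_normal_cdf_nondecreasing; rewrite lerD2l ler_pM2r ?invr_gt0.
have Gx := gumbel_cdf_nondecreasing _ _ xb.
(* 32 is [2! * 4 ^ 2], from [exp (- exp v) <= exp (- v) <= 2 / v ^ 2] at [v = b / 4]. *)
have Gb : gumbel_cdf (- (b / 4)) <= 32 * (b ^+ 2)^-1.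
  rewrite /gumbel_cdf opprK.
  have w0 := expR_gt0 (b / 4).
  apply: (@le_trans _ _ (expR (b / 4))^-1).
    rewrite expRN lef_pV2 ?posrE ?expR_gt0//.
    by rewrite (le_trans _ (expR_ge1Dx _))// lerDr.
  have b4 : 0 <= b / 4 by lra.
  have := exprn_expRN_le (b / 4) 2 b4; rewrite expRN => h.
  rewrite ler_pdivlMr ?exprn_gt0// mulrC.
  by move: h; rewrite (_ : 2`! = 2%N)// exprMn; lra.
(* Both values are nonnegative and at most [(76 + 2 k) / b ^ 2], where 76 is [44 + 32]. *)
move: (F0 (b + x / b)) (F0 (b + - (b / 4) / b)) (gumbel_cdf_ge0 x) Fx Gx Gb.
rewrite !ler_norml -/k => ? ? ? ? ? ? /andP[? ?].
have ? : 0 <= k * (b ^+ 2)^-1.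
  by rewrite !mulr_ge0 ?(ltW e0)// addr_ge0 ?invr_ge0 ?sqr_ge0.
by apply/andP; split; lra.
Qed.

(** * Lower bound at [x = 1] *)

(** With [u = exp (- 1)], Mills' bound gives [n p <= u / (1 + e)]. Passing from the power to the
    exponential costs at most half of this gain: the exponent stays below [u / (1 + e / 2)]. *)
Lemma skew_normal_pow_gap {R : realType} (lambda b : R) (n : nat) :
  (9 <= n)%N -> norming_eq n b ->
  expR (- expR (- 1)) * expR (- 1) / 3 * (b ^+ 2)^-1 <=
  skew_normal_cdf lambda (b + 1 / b) ^+ n - gumbel_cdf 1.
Proof.
move=> n9 nb; have b1 := norming_eq_ge1 _ _ n9 nb.
have b0 : 0 < b by exact: lt_le_trans b1.
have y0 : 0 < b + 1 / b by rewrite addr_gt0// divr_gt0.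
have n0 : (0 < n)%N by exact: leq_trans n9.
have nR : 0 < n%:R :> R by rewrite ltr0n.
have := norming_eq_tail _ _ 1 b0 y0 nb.
have bn := norming_eq_sqr_le _ _ b0 nb.
have b20 : 0 < b ^+ 2 by rewrite exprn_gt0.
rewrite skew_normal_cdf_tail /gumbel_cdf.
set p := skew_normal_tail _ _; set e := (b ^+ 2)^-1; set u := expR (- 1) => tE.
have e0 : 0 < e by rewrite invr_gt0.
have e1 : e <= 1 by rewrite invf_le1// exprn_ege1.
have u0 : 0 < u by exact: expR_gt0.
have u2 : u <= 2^-1.
  rewrite /u expRN lef_pV2 ?posrE ?expR_gt0//.
  by rewrite (le_trans _ (expR_ge1Dx _)).
have p0 : 0 <= p by exact: skew_normal_tail_ge0.
have np : n%:R * p <= u / (1 + e).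
  apply: (@le_trans _ _ (u * (expR (- (1 ^+ 2 / b ^+ 2 / 2)) / (1 + 1 / b ^+ 2)))).
    rewrite -tE ler_pM2l// (le_trans (skew_normal_tail_le _ _))// ler_pM2l//.
    exact: std_normal_tail_upper.
  rewrite mul1r -/e ler_pM2l// ler_piMl// ?invr_ge0 ?addr_ge0 ?(ltW e0)//.
  by rewrite expR_le1 oppr_le0 !divr_ge0// ltW.
(* Division by [n], with [1 / n <= e] since [b ^ 2 <= n]. *)
have pe : p <= u * e / (1 + e).
  rewrite [leRHS]mulrAC -(ler_pM2l nR) (le_trans np)//.
  rewrite mulrCA ler_peMr ?divr_ge0 ?addr_ge0 ?(ltW u0) ?(ltW e0)//.
  by rewrite ler_pdivlMr// mul1r.
have p1 : p < 1.
  rewrite (le_lt_trans pe)// ltr_pdivrMr; last lra.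
  have : u * e <= 1 * e by rewrite ler_pM2r//; lra.
  lra.
have lo := expr_onem_ge p n.
rewrite p0 p1 in lo; have {}lo := lo isT.
(* Amounts to [p (1 + e) <= e / 2], which follows from [pe] and [u <= 1 / 2]. *)
have D : n%:R * (p / (1 - p)) <= u / (1 + e / 2).
  rewrite mulrA ler_pdivrMr; last lra.
  rewrite (le_trans np)// mulrAC ler_pdivlMr; last lra.
  rewrite mulrAC ler_pdivrMr; last lra.
  rewrite -mulrA ler_pM2l//.
  have : p * (1 + e) <= u * e by rewrite -ler_pdivlMr//; lra.
  have : u * e <= 2^-1 * e by rewrite ler_pM2r.
  lra.
have DE : u - u / (1 + e / 2) = u * e / 2 / (1 + e / 2).
  by field; rewrite gt_eqF//; lra.
(* The 3 comes from [2 (1 + e / 2) = 2 + e <= 3]. *)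
have DE2 : u * e / 3 <= u - u / (1 + e / 2).
  have ue0 : 0 <= u * e by rewrite mulr_ge0// ltW.
  have ee0 : 0 <= u * e * (1 - e) by rewrite mulr_ge0//; lra.
  rewrite DE ler_pdivlMr; last lra.
  lra.
have lo2 : expR (- (u / (1 + e / 2))) <= (1 - p) ^+ n.
  by rewrite (le_trans _ lo)// ler_expR lerN2.
rewrite (@le_trans _ _ (expR (- u) * (u * e / 3)))//; first lra.
apply: (@le_trans _ _ (expR (- u) * (expR (u * e / 3) - 1))).
  by rewrite ler_wpM2l ?expR_ge0//; have := expR_ge1Dx (u * e / 3); lra.
rewrite mulrBr mulr1 lerD2r -expRD (le_trans _ lo2)// ler_expR; lra.
Qed.

(** * The two-sided rate for the supremum *)

Lemma skew_normal_pow_dist_le1 {R : realType} (lambda x y : R) (n : nat) :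
  `|skew_normal_cdf lambda y ^+ n - gumbel_cdf x| <= 1.
Proof.
have F0 : 0 <= skew_normal_cdf lambda y ^+ n.
  by rewrite exprn_ge0// skew_normal_cdf_ge0.
have F1 : skew_normal_cdf lambda y ^+ n <= 1.
  by rewrite exprn_ile1 ?skew_normal_cdf_ge0 ?skew_normal_cdf_le1.
have := gumbel_cdf_ge0 x; have := gumbel_cdf_le1 x.
by rewrite ler_norml => ? ?; apply/andP; split; lra.
Qed.

Theorem theorem2p2 (R : realType) (a b : nat -> R)
    (hb : forall n : nat, (0 < n)%N -> norming_eq n (b n))
    (ha : forall n : nat, (0 < n)%N -> a n = (b n)^-1) :
  exists2 C : R, 0 < C &
    forall lambda : R, 0 < lambda ->
      exists2 Clambda : R, 0 < Clambda &
        forall n : nat, (9 <= n)%N ->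
          C / ln n%:R <
            sup [set `|skew_normal_cdf lambda (a n * x + b n) ^+ n
                       - gumbel_cdf x| | x in [set: R]]
            < Clambda / ln n%:R.
Proof.
pose c : R := expR (- expR (- 1)) * expR (- 1) / 3.
have c0 : 0 < c by rewrite divr_gt0// mulr_gt0 ?expR_gt0.
(* [log n >= b_n ^ 2 / 2] turns the gap [c / b_n ^ 2] into at least [c / (2 log n)]; halving once
   more makes the inequality strict. *)
exists (c / 4); first by rewrite divr_gt0.
move=> lambda l0; pose k := 4 * (1 + (lambda ^+ 2)^-1).
have k0 : 0 <= k by rewrite !mulr_ge0// addr_ge0 ?invr_ge0 ?sqr_ge0.
pose B := 8 + 4 * k.
have B0 : 0 < B by rewrite /B; lra.
(* The 3 comes from [log n <= 3 b_n ^ 2], and [B ^ 2] covers the case [b_n < B], where the distance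
   is at most [1 <= B ^ 2 / b_n ^ 2]. The final 1 gives strictness. *)
exists (3 * (76 + 2 * k + B ^+ 2) + 1).
  by have := sqr_ge0 B; lra.
move=> n n9; have n0 : (0 < n)%N by exact: leq_trans n9.
have nb := hb n n0; have b1 := norming_eq_ge1 _ _ n9 nb.
have b0 : 0 < b n by exact: lt_le_trans b1.
have b20 : 0 < b n ^+ 2 by rewrite exprn_gt0.
have /andP[lnlo lnup] := norming_eq_ln _ _ b1 nb.
have ln0 : 0 < ln n%:R :> R by lra.
set S := [set _ | _ in _].
have yE x : a n * x + b n = b n + x / b n by rewrite ha// addrC mulrC.
have S1 x : S `|skew_normal_cdf lambda (b n + x / b n) ^+ n - gumbel_cdf x|.
  by exists x => //; rewrite yE.
apply/andP; split.
  (* [sup] bounds the elements of [S] only once [S] is known to be bounded above. *)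
  have Sub : has_ubound S by exists 1 => _ [x _ <-]; exact: skew_normal_pow_dist_le1.
  apply: lt_le_trans (ub_le_sup Sub (S1 1)).
  apply: lt_le_trans (ler_norm _).
  apply: lt_le_trans (skew_normal_pow_gap _ _ _ n9 nb).
  rewrite -/c ltr_pdivrMr// [ltRHS]mulrAC ltr_pdivlMr//.
  by have := ler_wpM2l (ltW c0) lnlo; have := mulr_gt0 c0 b20; lra.
apply: (@le_lt_trans _ _ ((76 + 2 * k + B ^+ 2) * (b n ^+ 2)^-1)).
  apply: ge_sup => [|_ [x _ <-]]; first by eexists; exact: (S1 0).
  rewrite yE mulrDl; have [bB|bB] := leP B (b n).
    apply: le_trans (skew_normal_pow_dist _ _ _ _ l0 n0 nb bB) _.
    by rewrite lerDl mulr_ge0 ?sqr_ge0// invr_ge0 ltW.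
  apply: le_trans (skew_normal_pow_dist_le1 _ _ _ _) _.
  rewrite ler_wpDl//; first by rewrite mulr_ge0 ?invr_ge0 ?(ltW b20)//; lra.
  by rewrite ler_pdivlMr// mul1r lerXn2r ?nnegrE// ltW.
set M := 76 + 2 * k + B ^+ 2.
have M0 : 0 < M by rewrite /M; have := sqr_ge0 B; lra.
rewrite ltr_pdivlMr// mulrAC ltr_pdivrMr//.
by have := ler_wpM2l (ltW M0) lnup; lra.
Qed.
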